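(* Let $1\le s\le d$ be integers. Then $$|\mathcal{P}_{s,d}|=\binom{s+d}{s}\,\frac{d+1-s}{d+1}.$$
   Context: $\mathbb{N}$ contains $0$. A sequence $e=(e_1,\dots,e_s)\in\mathbb{N}^s$ satisfies the Pólya condition if, with $n_i=|\{j : e_j<i\}|$, one has $n_i\le i$ for all integers $i\ge 0$. $\mathcal{P}_s$ denotes the set of non-increasing sequences $e_1\ge\dots\ge e_s$ in $\mathbb{N}^s$ satisfying the Pólya condition, and $\mathcal{P}_{s,d}=\{e\in\mathcal{P}_s : \max_i e_i<d\}$. *)

(* Defs.v *)
From mathcomp Require Import all_boot all_order all_algebra finmap.
From mathcomp Require Import boolp classical_sets functions cardinality.

Set Implicit Arguments.
Unset Strict Implicit.
Unset Printing Implicit Defensive.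

Local Open Scope classical_set_scope.

Definition num_below (s : nat) (e : s.-tuple nat) (i : nat) : nat :=
  #|[set j : 'I_s | tnth e j < i]%SET|.

Definition polya (s : nat) (e : s.-tuple nat) : Prop :=
  forall i : nat, num_below e i <= i.

Definition polya_seqs (s : nat) : set (s.-tuple nat) :=
  [set e : s.-tuple nat | sorted geq e /\ polya e].

Arguments polya_seqs s : clear implicits.

Definition polya_seqs_lt (s d : nat) : set (s.-tuple nat) :=
  [set e : s.-tuple nat | polya_seqs s e /\ \max_(j < s) tnth e j < d].

Arguments polya_seqs_lt s d : clear implicits.

(* Main.v *)
Require Import Defs.
From mathcomp Require Import all_boot all_order all_algebra finmap.
From mathcomp Require Import boolp classical_sets functions cardinality.
From mathcomp Require Import zify ring.

(** Read a non-increasing sequence from its largest term [x], and let [l] be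
    the remaining terms.  All terms are at most [x], so the Pólya condition at
    [x + 1] says exactly [size l <= x]; at larger indices it then holds for
    free, and at smaller indices it only involves [l].  Hence the Pólya
    sequences of length [s + 1] with terms below [d] are the [x :: l] with
    [s <= x < d] and [l] a Pólya sequence of length [s] with terms below
    [x + 1] ([polya_list_cons], [mem_polya_words]).

    Writing [N s d] for their number, this reads
    [N (s + 1) d = \sum_(s <= x < d) N s (x + 1)], so
    [N (s + 1) (d + 1) = N (s + 1) d + N s (d + 1)] as long as [s <= d], with
    boundary values [N 0 d = 1] and [N (s + 1) s = 0].  It is the recursion of
    the ballot numbers.  The difference
    ['C(s + d, d) - 'C(s + d, d + 1)] satisfies it by Pascal's rule applied to
    both terms, and has the same boundary values because binomial coefficients
    are symmetric ([size_polya_words]).  Finally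
    [(d + 1) 'C(s + d, d + 1) = s 'C(s + d, d)] turns the difference into the
    stated product. *)

Set Implicit Arguments.
Unset Strict Implicit.
Unset Printing Implicit Defensive.

Import Order.TTheory GRing.Theory Num.Theory.

Definition polya_list (l : seq nat) : Prop :=
  forall i, count (gtn i) l <= i.

Lemma num_belowE s (e : s.-tuple nat) i : num_below e i = count (gtn i) e.
Proof.
rewrite /num_below cardsE cardE size_filter -enumT -[RHS](congr1 _ (map_tnth_enum e)).
by rewrite count_map; apply: eq_count => j.
Qed.

(** Only the index [x + 1] brings a new constraint: it counts all the terms. *)
Lemma polya_list_cons x l : all (geq x) l ->
  polya_list (x :: l) <-> size l <= x /\ polya_list l.
Proof.
move=> lx; split=> [H | [sx H] i /=].
  split=> [|i]; last by apply: leq_trans (H i); rewrite /= leq_addl.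
  have := H x.+1; rewrite /= ltnSn add1n ltnS; apply: leq_trans.
  by move: lx; rewrite all_count => /eqP <-; apply: sub_count => y /=.
have [xi | _] := ltnP x i; last exact: H.
apply: leq_trans xi; rewrite add1n ltnS.
exact: leq_trans (count_size _ _) sx.
Qed.

Fixpoint polya_words (s d : nat) : seq (seq nat) :=
  if s is s'.+1 then
    [seq x :: l | x <- iota s' (d - s'), l <- polya_words s' x.+1]
  else [:: [::]].

Lemma mem_polya_words s d l :
  l \in polya_words s d <->
  [/\ size l = s, sorted geq l, polya_list l & all (gtn d) l].
Proof.
elim: s d l => [|s IHs] d l /=.
  rewrite inE; split=> [/eqP -> // | [/size0nil -> //]].
split.
  case/allpairsPdep=> x [m [xr /IHs[sm om pm mx] ->]].
  rewrite mem_iota in xr; have xd : x < d by lia.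
  split; rewrite /= ?sm ?path_sortedE ?om ?andbT //.
  - exact: (rev_trans leq_trans).
  - by apply/polya_list_cons => //; rewrite sm; case/andP: xr.
  - by rewrite xd; apply: sub_all mx => y /= yx; apply: leq_trans xd.
case: l => [[]//|x m [/= [sm]]].
rewrite path_sortedE; last exact: (rev_trans leq_trans).
case/andP=> mx om /(polya_list_cons mx)[sx pm] /andP[xd _].
apply/allpairsPdep; exists x, m; split=> //.
  by rewrite mem_iota; lia.
by apply/IHs; split.
Qed.

Lemma polya_words_uniq s d : uniq (polya_words s d).
Proof.
elim: s d => [//|s IHs] d /=.
apply: allpairs_uniq_dep => [|x _|]; [exact: iota_uniq|exact: IHs|].
by move=> [x l] [y m] _ _ /= [-> ->].
Qed.

Lemma size_polya_wordsS s d : size (polya_words s.+1 d) =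
  \sum_(s <= x < d) size (polya_words s x.+1).
Proof.
by rewrite /= size_allpairs_dep sumnE big_map.
Qed.

Lemma size_polya_wordsSS s d : s <= d -> size (polya_words s.+1 d.+1) =
  size (polya_words s.+1 d) + size (polya_words s d.+1).
Proof. by move=> sd; rewrite !size_polya_wordsS big_nat_recr. Qed.

(** Additive form of the ballot number ['C(s + d, d) - 'C(s + d, d.+1)].  The
    case [s = d.+1], where no sequence exists, is included because it starts
    the induction on [d] at fixed [s]; the two binomials then agree by
    symmetry. *)
Lemma size_polya_words s d : s <= d.+1 ->
  size (polya_words s d) + 'C(s + d, d.+1) = 'C(s + d, d).
Proof.
elim: s d => [|s IHs] d; first by rewrite bin_small ?binn.
rewrite ltnS => /subnK <-; elim: (d - s) => [|k IHk].
  rewrite size_polya_wordsS big_geq // add0n add0n.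
  by rewrite -bin_sub ?addSn ?ltnS ?leq_addl // subSS addnK.
rewrite [k.+1 + s]addSn; move: (k + s) (leq_addl k s) IHk => n sn IHn.
have := IHs n.+1 (leqW (leqW sn)).
by rewrite size_polya_wordsSS // !addSn !addnS !binS in IHn *; lia.
Qed.

Local Open Scope ring_scope.

Theorem proposition3p12 (s d : nat) (hs : (1 <= s)%N) (hsd : (s <= d)%N) :
  finite_set (polya_seqs_lt s d) /\
  (#|` fset_set (polya_seqs_lt s d)|%fset)%:R =
    ('C(s + d, s))%:R * ((d%:R + 1 - s%:R) / (d%:R + 1)) :> rat.
Proof.
pose ts : seq (s.-tuple nat) := pmap insub (polya_words s d).
have words_size l : l \in polya_words s d -> size l == s.
  by case/mem_polya_words=> ->.
have size_ts : size ts = size (polya_words s d).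
  by rewrite size_pmap_sub; apply/eqP; rewrite -all_count; apply/allP.
have uniq_ts : uniq ts by apply: pmap_sub_uniq; exact: polya_words_uniq.
have tsE : polya_seqs_lt s d = [set` [fset e in ts]%fset]%classic.
  apply/seteqP; split=> e /=; rewrite inE /= mem_pmap_sub.
    case=> -[oe pe] me; apply/mem_polya_words; split=> //.
    - exact: size_tuple.
    - by move=> i; rewrite -num_belowE; apply: pe.
    - apply/all_tnthP => j /=; apply: leq_ltn_trans me.
      exact: (leq_bigmax (F := tnth e)).
  case/mem_polya_words=> _ oe pe /all_tnthP me; split.
    by split=> // i; rewrite num_belowE; apply: pe.
  have d0 : (0 < d)%N := leq_trans hs hsd.
  by rewrite -(prednK d0) ltnS; apply/bigmax_leqP => j _; have /= := me j; lia.
rewrite tsE; split; first exact: finite_fset.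
rewrite set_fsetK card_fseq undup_id // size_ts.
have /(congr1 (fun n => n%:R : rat)) := size_polya_words (leqW hsd).
have /(congr1 (fun n => n%:R : rat)) := mul_bin_left (s + d) d.
rewrite addnK -(@bin_sub (s + d) d) ?leq_addl // addnK !natrM natrD -natr1.
have d0 : d%:R + 1 != 0 :> rat by rewrite natr1 pnatr_eq0.
move=> E1 E2; apply: (mulIf d0); rewrite -mulrA divfK //.
move/(canRL (addrK _)): E2 => ->; rewrite mulrBl [X in _ - X]mulrC E1; ring.
Qed.
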